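(* Let $q$, $a$ and $b$ be integers such that $q \geq 2$, $a \geq 1$ and $b \geq -a$, and let $(v_n)_{n \in \mathbb{N}}$ be the sequence of natural numbers whose general term is $v_n = a q^n + b$ for all $n \in \mathbb{N}$. Suppose that $\gcd(a q, b) = \gcd(a + b, q - 1) = 1$ and set $$B' := \max\left(a (q - 1), \frac{b (q - 1) + 1}{2}\right).$$ Then, for any positive integer $n$, we have $$\mathrm{lcm}\{v_1, v_2, \dots, v_n\} \geq (a q + b) \left(\frac{a (q - 1) + 1}{2 \sqrt{B'}}\right)^{n - 1} q^{\frac{(n - 1)(n - 4)}{4}}.$$
   Context: $\mathbb{N}$ is the set of non-negative integers. *)

(* Defs.v *)
From mathcomp Require Import all_boot all_order all_algebra.
From mathcomp Require Import reals exp.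

(* Main.v *)
(** Writing [j] = 1 + q + ... + q^(j-1) and r = a(q-1), one has
    v_(k+j) = v_k + r q^k [j].  Any common multiple L of v_k, ..., v_(k+m)
    satisfies v_k ... v_(k+m) | L [1] ... [m]: by induction on m applied to the
    two subwindows of length m, the product divides L [1] ... [m-1] times both
    v_k and v_(k+m), hence times their difference r q^k [m], and it is coprime
    to r q^k.  As v_(k+j) >= r q^k [j] and v_k >= v_1, this gives
    L >= v_1 (r q^k)^m.  With m the integer part of n/2 and k = n - m, this
    exceeds the claimed bound, because (r+1) / (2 sqrt B') <= sqrt r. *)
Require Import Defs.
From mathcomp Require Import all_boot all_order all_algebra.
From mathcomp Require Import reals exp.
From mathcomp Require Import zify ring lra.

Import Order.TTheory GRing.Theory Num.Theory.
Local Open Scope ring_scope.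

Definition qnum (q : int) (j : nat) : int := \sum_(i < j) q ^+ i.

Lemma dvdz_leq (d m : int) : 0 < m -> (d %| m)%Z -> d <= m.
Proof.
move=> m0 /dvdn_leq h; have : (`|d| <= `|m|)%N by apply: h; lia.
lia.
Qed.

Lemma qnum_gt0 (q : int) (j : nat) : 2 <= q -> 0 < qnum q j.+1.
Proof.
move=> hq; rewrite /qnum big_ord_recl expr0.
apply: ltr_wpDr => //; apply: sumr_ge0 => i _; apply: exprn_ge0; lia.
Qed.

Lemma geom_shift (q a b : int) (k j : nat) :
  a * q ^+ (k + j) + b =
  (a * q ^+ k + b) + a * (q - 1) * q ^+ k * qnum q j.
Proof.
have E : q ^+ j = 1 + (q - 1) * qnum q j by rewrite -subrX1 addrC subrK.
by rewrite exprD E; ring.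
Qed.

(** Each factor of the right-hand side is treated separately: the term is congruent to b modulo a,
    to b modulo q because its exponent is positive, and to a + b modulo q - 1. *)
Lemma coprimez_geom (q a b : int) (k : nat) : (0 < k)%N ->
  gcdz (a * q) b = 1 -> gcdz (a + b) (q - 1) = 1 ->
  forall i, coprimez (a * q ^+ (k + i) + b) (a * (q - 1) * q ^+ k).
Proof.
move=> k0 /eqP h1 /eqP h2 i.
have {h1} : coprimez (a * q) b by [].
rewrite coprimezMl => /andP[hab hqb].
have {}h2 : coprimez (a + b) (q - 1) by [].
have Ea : coprimez (a * q ^+ (k + i) + b) a.
  by rewrite coprimez_sym /coprimez mulrC gcdzMDl.
have Eq : coprimez (a * q ^+ (k + i) + b) q.
  by rewrite -(prednK k0) coprimez_sym /coprimez addSn exprSr mulrA gcdzMDl.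
have Er : coprimez (a * q ^+ (k + i) + b) (q - 1).
  have := geom_shift q a b 0 (k + i); rewrite add0n expr0 !mulr1 => ->.
  by rewrite coprimez_sym /coprimez mulrAC [X in gcdz _ X]addrC gcdzMDl gcdzC.
by rewrite !coprimezMr Ea Er coprimezXr.
Qed.

Lemma dvdz_prod_window (q a b : int) (L : int) (m k : nat) : (0 < k)%N ->
  gcdz (a * q) b = 1 -> gcdz (a + b) (q - 1) = 1 ->
  (forall i, (i <= m)%N -> (a * q ^+ (k + i) + b %| L)%Z) ->
  (\prod_(i < m.+1) (a * q ^+ (k + i) + b)
     %| L * \prod_(j < m) qnum q j.+1)%Z.
Proof.
elim: m k => [|m IH] k k0 h1 h2 hL.
  by rewrite big_ord1 big_ord0 mulr1; apply: hL.
have cop : coprimez (\prod_(i < m.+2) (a * q ^+ (k + i) + b))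
    (a * (q - 1) * q ^+ k).
  apply: (big_ind (fun x => coprimez x (a * (q - 1) * q ^+ k))).
  - exact: coprime1n.
  - by move=> x y hx hy; rewrite coprimezMl hx.
  - by move=> i _; apply: coprimez_geom.
set F := \prod_(j < m) qnum q j.+1.
have low : (\prod_(i < m.+2) (a * q ^+ (k + i) + b)
    %| L * F * (a * q ^+ (k + m.+1) + b))%Z.
  rewrite big_ord_recr; apply: dvdz_mul => //.
  by apply: IH => // i hi; apply: hL; lia.
(* Here [IH] is used at [k.+1], hence the induction on [m] with [k] general. *)
have high : (\prod_(i < m.+2) (a * q ^+ (k + i) + b)
    %| L * F * (a * q ^+ k + b))%Z.
  rewrite big_ord_recl addn0 mulrC; apply: dvdz_mul => //.
  under eq_bigr => i _ do rewrite lift0 addnS -addSn.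
  by apply: IH => // i hi; rewrite addSn -addnS; apply: hL; lia.
move: (rpredB low high); rewrite -mulrBr geom_shift addrAC subrr add0r mulrCA.
rewrite [_ \in _]Gauss_dvdzr // -mulrA => dvd_L.
by rewrite [X in (_ %| _ * X)%Z]big_ord_recr.
Qed.

Lemma window_lcm_ge (q a b L : int) (m k : nat) : (0 < k)%N ->
  2 <= q -> 1 <= a -> - a <= b ->
  gcdz (a * q) b = 1 -> gcdz (a + b) (q - 1) = 1 -> 0 < L ->
  (forall i, (i <= m)%N -> (a * q ^+ (k + i) + b %| L)%Z) ->
  (a * q + b) * (a * (q - 1) * q ^+ k) ^+ m <= L.
Proof.
move=> k0 hq ha hb h1 h2 L0 hL.
have F0 : 0 < \prod_(j < m) qnum q j.+1.
  by apply: prodr_gt0 => j _; apply: qnum_gt0.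
have qk : q <= q ^+ k by apply: ler_eXnr; lia.
have r0 : 0 <= a * (q - 1) by apply: mulr_ge0; lia.
have rk0 : 0 <= a * (q - 1) * q ^+ k by apply: mulr_ge0 => //; lia.
have v1 : a * q + b <= a * q ^+ k + b by rewrite lerD2r ler_wpM2l //; lia.
have v1_ge0 : 0 <= a * q + b by nia.
(* After multiplication by [1] ... [m] the factors pair off: v_k against v_1, and v_(k+j) against r
   q^k [j] for 1 <= j <= m. *)
rewrite -(ler_pM2r F0).
apply: (@le_trans _ _ (\prod_(i < m.+1) (a * q ^+ (k + i) + b))).
  rewrite big_ord_recl addn0 -[leLHS]mulrA; apply: ler_pM => //.
    apply: mulr_ge0; [exact: exprn_ge0|exact: ltW].
  rewrite -[m in _ ^+ m]card_ord -prodr_const -big_split.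
  apply: ler_prod => j _; rewrite lift0.
  rewrite mulr_ge0 ?(ltW (qnum_gt0 _ _ _)) //= geom_shift lerDr.
  exact: le_trans v1.
apply: dvdz_leq; first exact: mulr_gt0.
exact: dvdz_prod_window.
Qed.

Theorem corollary1p5 (R : realType) (q a b : int) (v : nat -> nat)
    (hq : 2 <= q) (ha : 1 <= a) (hb : - a <= b)
    (hv : forall n : nat, (v n)%:Z = a * q ^+ n + b)
    (hgcd1 : gcdz (a * q) b = 1) (hgcd2 : gcdz (a + b) (q - 1) = 1)
    (n : nat) (hn : (0 < n)%N) :
  let B' : R := Num.max (a * (q - 1))%:~R ((b * (q - 1) + 1)%:~R / 2) in
  (\big[lcmn/1%N]_(1 <= i < n.+1) v i)%:R >=
    (a * q + b)%:~R * ((a * (q - 1) + 1)%:~R / (2 * Num.sqrt B')) ^+ (n - 1)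
      * (q%:~R `^ ((n%:R - 1) * (n%:R - 4) / 4)) :> R.
Proof.
cbv zeta; set B' := Num.max _ _; set L := \big[lcmn/1%N]_(1 <= i < n.+1) v i.
(* For i >= 1, v_i >= a q - a > 0. The range has to start at 1: v_0 = 0 when q = 2, a = 1, b =
   -1. *)
have L_gt0 : (0 < L)%N.
  rewrite /L big_nat; apply: (big_ind (fun x => (0 < x)%N)) => //.
    by move=> x y hx hy; rewrite lcmn_gt0 hx.
  move=> i /andP[i0 _]; have := hv i.
  have : q <= q ^+ i by apply: ler_eXnr; lia.
  nia.
have vL i : (0 < i <= n)%N -> (a * q ^+ i + b %| L%:Z)%Z.
  move=> /andP[i0 iN]; rewrite -hv /L.
  rewrite (big_rem i) ?mem_index_iota ?i0 //=.
  exact: dvdn_lcml.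
(* A balanced split of n makes the exponent k m of q largest; rounding k up keeps it positive when n
   = 1. *)
set m := n./2; set k := uphalf n.
have km : (k + m = n)%N by rewrite /k /m; lia.
have k0 : (0 < k)%N by rewrite /k; lia.
have mk : (m <= k <= m.+1)%N by rewrite /k /m; lia.
have key : (a * q + b) * (a * (q - 1) * q ^+ k) ^+ m <= L%:Z.
  apply: window_lcm_ge => // i hi; apply: vL; lia.
have r1 : 1 <= a * (q - 1) by nia.
have v1_ge0 : 0 <= a * q + b by nia.
rewrite -(@ler_int R) intrM !rmorphXn /= intrM in key.
apply: le_trans key.
rewrite -mulrA; apply: ler_wpM2l; first by rewrite ler0z.
rewrite rmorphXn /= [leRHS]exprMn -exprM.
set r : R := (a * (q - 1))%:~R in B' *.
have r1R : 1 <= r by rewrite ler1z.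
have s1 : 1 <= Num.sqrt r by rewrite -sqrtr1 ler_wsqrtr.
have B'r : Num.sqrt r <= Num.sqrt B' by rewrite ler_wsqrtr // /B' le_max lexx.
have sr : Num.sqrt r ^+ 2 = r by rewrite sqr_sqrtr; lra.
apply: ler_pM.
- apply: exprn_ge0; apply: divr_ge0; first by rewrite ler0z; lia.
  by rewrite mulr_ge0 ?sqrtr_ge0.
- exact: powR_ge0.
- apply: (@le_trans _ _ (Num.sqrt r ^+ (n - 1))).
    apply: lerXn2r; rewrite ?nnegrE ?sqrtr_ge0 //.
      by apply: divr_ge0; [rewrite ler0z; lia|rewrite mulr_ge0 ?sqrtr_ge0].
    (* Since B' >= r >= 1, 2 sqrt r sqrt B' >= 2 r >= r + 1. *)
    rewrite intrD mulr1z -/r ler_pdivrMr; last by lra.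
    nra.
  (* r^m = (sqrt r)^(2m), with sqrt r >= 1 and n - 1 <= 2m. *)
  rewrite -[in leRHS]sr -exprM; apply: ler_weXn2l => //; lia.
- rewrite -powR_mulrn; last by rewrite ler0z; lia.
  apply: ler_powR; first by rewrite ler1z; lia.
  have nR : n%:R = k%:R + m%:R :> R by rewrite -natrD km.
  have k1 : 1 <= k%:R :> R by rewrite ler1n.
  have m0 : 0 <= m%:R :> R by rewrite ler0n.
  case/andP: mk => mk1 mk2.
  have mk1R : m%:R <= k%:R :> R by rewrite ler_nat.
  have mk2R : k%:R <= m%:R + 1 :> R by rewrite natr1 ler_nat.
  (* With n = k + m, (n - 1)(n - 4) <= 4 k m amounts to (k - m)^2 <= 5 n - 4, and 0 <= k - m <= 1 <=
     n. *)
  rewrite natrM nR; nra.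
Qed.
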